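(* In the category of hypercoherences and linear maps, for every hypercoherence $A$: (i) $\mathrm{flag}$ is self-dual: $(\mathrm{flag}\,A)^{\perp}=\mathrm{flag}(A^{\perp})$; (ii) $A$ is a retract of $\mathrm{flag}\,A$, i.e. there are linear maps $f:A\to\mathrm{flag}\,A$ and $t:\mathrm{flag}\,A\to A$ with $t\circ f=\mathrm{Id}_A$; (iii) $\mathrm{flag}\,A$ is isomorphic to $(\mathrm{flag}\,A)\triangleleft(\mathrm{flag}\,A)$.
   Context: $\#M$ denotes the cardinality of a set $M$, and $\mathcal{P}^*_{\mathrm{fin}}(M)$ the set of finite nonempty subsets of $M$. A hypercoherence $X$ consists of a set $|X|$ (its web) and a set $\Gamma(X)\subset\mathcal{P}^*_{\mathrm{fin}}(|X|)$ (atomic coherence) containing all singletons. Strict atomic coherence $\Gamma^*(X)$ is $\Gamma(X)$ minus all singletons; a hypercoherence is determined by its web and $\Gamma^*(X)$. Negation: $X^{\perp}=(|X|,\ \mathcal{P}^*_{\mathrm{fin}}(|X|)\setminus\Gamma^*(X))$. Linear implication: $X\multimap Y$ has web $|X|\times|Y|$, and a finite nonempty $w\subset|X|\times|Y|$, with projections $w_1$ on $|X|$ and $w_2$ on $|Y|$, is in $\Gamma(X\multimap Y)$ iff: (if $w_1\in\Gamma(X)$ then $w_2\in\Gamma(Y)$) and (if $w_1\in\Gamma(X)$ and $\#w_1\ge2$ then $w_2\in\Gamma(Y)$ and $\#w_2\geq 2$). A linear map from $X$ to $Y$ is a subset of $|X|\times|Y|$ all of whose finite nonempty subsets belong to $\Gamma(X\multimap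 Y)$; linear maps compose as relations, and the identity is the diagonal. Before: $X\triangleleft Y$ has web $|X|\times|Y|$, and a finite nonempty $w\subset |X|\times|Y|$, with projections $\pi_1(w)$ on $|X|$ and $\pi_2(w)$ on $|Y|$, is in $\Gamma^*(X\triangleleft Y)$ iff $\pi_1(w)\in\Gamma^*(X)$ or [$\#\pi_1(w)=1$ and $\pi_2(w)\in\Gamma^*(Y)$]. Let $2^{\omega}$ be the set of infinite words on $\{0,1\}$, with the product topology (Cantor space) and the lexicographic total order: $w_1<w_2$ iff there are a finite word $m$ and infinite words $w_1',w_2'$ with $w_1=m0w_1'$ and $w_2=m1w_2'$. Flag: $\mathrm{flag}\,X$ is the hypercoherence whose web is the set of continuous functions from $2^\omega$ to $|X|$ (with the discrete topology on $|X|$), and $\{f_1,\dots,f_k\}\in\Gamma^*(\mathrm{flag}\,X)$ iff there exists $u\in2^\omega$ such that $\{f_1(u),\dots,f_k(u)\}\in\Gamma^*(X)$ and $\#\{f_1(u'),\dots,f_k(u')\}=1$ for all $u'<u$. *)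

(* Defs.v *)
From HB Require Import structures.
From mathcomp Require Import all_boot.
From mathcomp Require Import all_classical.
From mathcomp Require Import topology cantor.
Set Implicit Arguments.
Unset Strict Implicit.
Unset Printing Implicit Defensive.

Local Open Scope classical_set_scope.
Local Open Scope card_scope.

Definition finite_nonempty {T : Type} : set (set T) :=
  [set w | finite_set w /\ w !=set0].

Definition singletons {T : Type} : set (set T) := range set1.

Record hypercoherence := Hypercoherence {
  web : Type;
  coh : set (set web);
  coh_finite_nonempty : coh `<=` finite_nonempty;
  coh_singletons : singletons `<=` coh }.

Arguments coh : clear implicits.

Definition strict_coh (X : hypercoherence) : set (set (web X)) :=
  coh X `\` singletons.

Arguments strict_coh : clear implicits.

Lemma singletons_finite_nonempty (T : Type) :
  singletons `<=` @finite_nonempty T.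
Proof. by move=> _ [x _ <-]; split; [exact: finite_set1 | exists x]. Qed.

Lemma card_geI2_set1 (T : Type) (x : T) : ~ (`I_2 #<= [set x]).
Proof. by rewrite (card_le_eqr card_set1) card_le_II. Qed.

Section of_strict.
Context (T : Type) (G : set (set T)).

Let C : set (set T) := (finite_nonempty `&` G) `|` singletons.

Let C_finite_nonempty : C `<=` finite_nonempty.
Proof. by move=> w [[] //|]; exact: singletons_finite_nonempty. Qed.

Let C_singletons : singletons `<=` C.
Proof. by move=> w; right. Qed.

(* The hypercoherence on T whose strict atomic coherence is G; see
   [strict_coh_of_strict]. *)
Definition of_strict : hypercoherence :=
  Hypercoherence C_finite_nonempty C_singletons.

Lemma strict_coh_of_strict :
  G `<=` finite_nonempty -> (forall x, ~ G [set x]) ->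
  strict_coh of_strict = G.
Proof.
move=> Gfin Gset1; apply/seteqP; split=> [w [[[]//|//]]|w Gw].
split; first by left; split=> //; exact: Gfin.
by case=> x _ wx; apply: (Gset1 x); rewrite wx.
Qed.

End of_strict.

Section dual.
Context (X : hypercoherence).

Let C : set (set (web X)) := finite_nonempty `\` strict_coh X.

Let C_finite_nonempty : C `<=` finite_nonempty.
Proof. by move=> w []. Qed.

Let C_singletons : singletons `<=` C.
Proof.
by move=> w sw; split; [exact: singletons_finite_nonempty | case].
Qed.

Definition dual : hypercoherence :=
  Hypercoherence C_finite_nonempty C_singletons.

End dual.

Section limpl.
Context (X Y : hypercoherence).

Let C : set (set (web X * web Y)) :=
  [set w | [/\ finite_nonempty w,
     coh X (fst @` w) -> coh Y (snd @` w) &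
     coh X (fst @` w) /\ `I_2 #<= fst @` w ->
     coh Y (snd @` w) /\ `I_2 #<= snd @` w]].

Let C_finite_nonempty : C `<=` finite_nonempty.
Proof. by move=> w []. Qed.

Let C_singletons : singletons `<=` C.
Proof.
move=> w sw; split; first exact: singletons_finite_nonempty.
- by case: sw => p _ <- _; rewrite image_set1; apply: coh_singletons; exists p.2.
- by case: sw => p _ <- [_]; rewrite image_set1 => c; case: (card_geI2_set1 c).
Qed.

Definition limpl : hypercoherence :=
  Hypercoherence C_finite_nonempty C_singletons.

End limpl.

Definition linear_map (X Y : hypercoherence) (f : set (web X * web Y)) : Prop :=
  forall w, finite_nonempty w -> w `<=` f -> coh (limpl X Y) w.

Arguments linear_map : clear implicits.

Definition lid (X : hypercoherence) : set (web X * web X) := diagonal.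

Arguments lid : clear implicits.

(* [g \; f] relates x to z when f relates x to some y and g relates y to z,
   that is, it is g after f. *)
Definition lcomp (T U V : Type) (g : set (U * V)) (f : set (T * U)) :
    set (T * V) :=
  (g \; f)%relation.

Definition retract (X Y : hypercoherence) : Prop :=
  exists (f : set (web X * web Y)) (t : set (web Y * web X)),
    [/\ linear_map X Y f, linear_map Y X t & lcomp t f = lid X].

Definition isomorphic (X Y : hypercoherence) : Prop :=
  exists (f : set (web X * web Y)) (g : set (web Y * web X)),
    [/\ linear_map X Y f, linear_map Y X g, lcomp g f = lid X & lcomp f g = lid Y].

Definition before_strict (X Y : hypercoherence) : set (set (web X * web Y)) :=
  [set w | finite_nonempty w /\
    (strict_coh X (fst @` w) \/
     (fst @` w #= `I_1 /\ strict_coh Y (snd @` w)))].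

Arguments before_strict : clear implicits.

Definition before (X Y : hypercoherence) : hypercoherence :=
  of_strict (before_strict X Y).

Lemma strict_coh_before (X Y : hypercoherence) :
  strict_coh (before X Y) = before_strict X Y.
Proof.
apply: strict_coh_of_strict => [w []//|p [_]]; rewrite !image_set1.
by case=> [[_]|[_ [_]]]; apply; [exists p.1 | exists p.2].
Qed.

(* The infinite word m u: past the end of m, [nth] returns its default, taken
   here to be the letter of u at the shifted position. *)
Definition wcat (m : seq bool) (u : cantor_space) : cantor_space :=
  fun i => nth (u (i - size m)%N) m i.

Definition lex_lt (u v : cantor_space) : Prop :=
  exists (m : seq bool) (u' v' : cantor_space),
    u = wcat (rcons m false) u' /\ v = wcat (rcons m true) v'.

(* [{classic T}] is T with the classical choiceType structure that the
   library's discrete topology asks for. *)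
Definition flag_web (T : Type) : Type :=
  continuousType cantor_space (discrete_topology {classic T}).

Definition flag_eval (T : Type) (u : cantor_space) (f : flag_web T) : T := f u.

Definition flag_strict (X : hypercoherence) : set (set (flag_web (web X))) :=
  [set F | finite_nonempty F /\
    exists u : cantor_space, strict_coh X (flag_eval u @` F) /\
      forall u', lex_lt u' u -> flag_eval u' @` F #= `I_1].

Arguments flag_strict : clear implicits.

Definition flag (X : hypercoherence) : hypercoherence :=
  of_strict (flag_strict X).

Lemma strict_coh_flag (X : hypercoherence) :
  strict_coh (flag X) = flag_strict X.
Proof.
apply: strict_coh_of_strict => [w []//|f [_ [u []]]]; rewrite image_set1.
by case=> _ + _; apply; exists (flag_eval u f).
Qed.

(* Main.v *)
(* Let F be a finite set of at least two continuous functions on Cantor space.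
   The words at which the elements of F do not all agree form a nonempty closed
   set, which has a lexicographically least element u.  As the lexicographic
   order is total, u is the only possible witness of the strict coherence of F
   in flag A and in flag (dual A), and it is one for exactly one of them: this
   gives (i).  For (ii), send a to the constant function at a.  For (iii), split
   f into its restrictions to the two halves 0 2^omega and 1 2^omega: the witness
   u of the strict coherence of F lies either in the first half, or in the second
   one with F constant on the first half, as in the two cases of the definition
   of "before". *)
From mathcomp Require Import all_boot.
From mathcomp Require Import all_classical.
From mathcomp Require Import topology cantor.
Require Import Defs.
Set Implicit Arguments.
Unset Strict Implicit.
Unset Printing Implicit Defensive.

Local Open Scope classical_set_scope.
Local Open Scope card_scope.

(** * Singletons, images and coherence *)

Lemma singletonsP (T : Type) (w : set T) (x : T) : w x ->
  singletons w <-> forall y, w y -> y = x.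
Proof.
move=> wx; split=> [[z _ zw] y|wE].
  by move: wx; rewrite -zw => -> ->.
by exists x => //; apply/seteqP; split=> [y ->//|y /wE].
Qed.

Lemma card_eq1P (T : Type) (w : set T) : w #= `I_1 <-> singletons w.
Proof.
split=> [/pcard_eqP/unsquash f|[x _ <-]]; last exact: card_set1.
have [_ fI /(_ 0 isT)[x wx _]] := 'bij_f.
apply/(singletonsP wx) => y wy; apply: fI; rewrite ?inE//.
have f0 z : w z -> f z = 0 by move=> /('funS_f) /=; case: (f z).
by rewrite !f0.
Qed.

Lemma finite_nonempty_image (T U : Type) (h : T -> U) (w : set T) :
  finite_nonempty w -> finite_nonempty (h @` w).
Proof.
move=> [fw [x wx]]; split; first exact: finite_image.
by exists (h x), x.
Qed.

Lemma singletons_image (T U : Type) (h : T -> U) (w : set T) :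
  injective h -> singletons (h @` w) <-> singletons w.
Proof.
move=> hI; split=> [[y _ yw]|[x _ <-]]; last by exists (h x); rewrite ?image_set1.
have [x wx _] : (h @` w) y by rewrite -yw.
apply/(singletonsP wx) => z wz; apply: hI.
have : (h @` w) (h z) by exists z.
have : (h @` w) (h x) by exists x.
by rewrite -yw => -> ->.
Qed.

Lemma coh_strictP (X : hypercoherence) (w : set (web X)) :
  coh X w <-> strict_coh X w \/ singletons w.
Proof.
split=> [cw|[[]//|]]; last exact: coh_singletons.
by have [sw|nsw] := pselect (singletons w); [right | left].
Qed.

(** * Linear maps induced by injections that preserve and reflect strict coherence *)

Section embedding.
Context (X Y : hypercoherence) (h : web X -> web Y).
Hypothesis h_inj : injective h.
Hypothesis h_strict : forall w, finite_nonempty w ->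
  strict_coh X w <-> strict_coh Y (h @` w).

Let h_coh (w : set (web X)) : finite_nonempty w -> coh X w <-> coh Y (h @` w).
Proof. by move=> fw; rewrite !coh_strictP h_strict// singletons_image. Qed.

Let h_card (w : set (web X)) : h @` w #= w.
Proof. by apply: inj_card_eq => x y _ _; exact: h_inj. Qed.

(** On a subset of the graph, the second projection is the [h]-image of the first, and [h] preserves
    and reflects both coherence and cardinality. The same symmetry makes the converse relation
    linear. *)
Lemma linear_map_graph : linear_map X Y [set p | h p.1 = p.2].
Proof.
move=> w fw wh; have /= fw1 := finite_nonempty_image fst fw.
have w2 : snd @` w = h @` (fst @` w).
  by rewrite image_comp; apply: eq_imagel => p /wh /=.
split=> //; rewrite w2 -h_coh// => -[? ?]; split=> //.
by rewrite (card_le_eqr (h_card _)).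
Qed.

Lemma linear_map_converse_graph : linear_map Y X [set p | h p.2 = p.1].
Proof.
move=> w fw wh; have /= fw2 := finite_nonempty_image snd fw.
have w1 : fst @` w = h @` (snd @` w).
  by rewrite image_comp; apply: eq_imagel => p /wh /=.
split=> //; rewrite w1 -h_coh// => -[? ?]; split=> //.
by rewrite -(card_le_eqr (h_card _)).
Qed.

Let graph_converse :
  lcomp [set p | h p.2 = p.1] [set p | h p.1 = p.2] = lid X.
Proof.
apply/seteqP; split=> [[x z] [y /= <- /h_inj ->]//|[x z]].
by rewrite /lid /diagonal /= => ->; exists (h z).
Qed.

Lemma retract_embedding : retract X Y.
Proof.
by exists [set p | h p.1 = p.2], [set p | h p.2 = p.1]; split;
  [exact: linear_map_graph | exact: linear_map_converse_graph |].
Qed.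

Lemma isomorphic_embedding : (forall y, exists x, h x = y) -> isomorphic X Y.
Proof.
move=> hS; exists [set p | h p.1 = p.2], [set p | h p.2 = p.1]; split;
  [exact: linear_map_graph | exact: linear_map_converse_graph |
   exact: graph_converse |].
apply/seteqP; split=> [[x z] [y /= <- <-]//|[x z]].
by rewrite /lid /diagonal /= => ->; have [y yz] := hS z; exists y.
Qed.

End embedding.

(** * Cantor space and its lexicographic order *)

Lemma cvg_cantor (T : Type) (F : set_system T) (f : T -> cantor_space)
    (u : cantor_space) : Filter F ->
  (forall n, \forall x \near F, f x n = u n) -> f @ F --> u.
Proof.
(* The product topology is the supremum of the topologies pulled back along the letters, so one
   letter is tested at a time. *)
move=> FF fu; apply/cvg_sup => n A [_ [[B Bopen <-] Bu BA]].
by apply: filterS (fu n) => x fxn; apply: BA; rewrite /= fxn.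
Qed.

Lemma near_letter (u : cantor_space) n : \forall v \near u, v n = u n.
Proof. exact: (@proj_continuous _ (fun=> bool) n u [set u n] (discrete_set1 _)). Qed.

Lemma continuous_discreteP (X : topologicalType) (Y : discreteTopologicalType)
    (f : X -> Y) : continuous f <-> forall u, \forall v \near u, f v = f u.
Proof.
by split=> fC u; apply/(@discrete_cvg Y (f @ u) (f u) _); exact: fC.
Qed.

Lemma lex_ltP (u v : cantor_space) : lex_lt u v <->
  exists n, [/\ forall i, (i < n)%N -> u i = v i, u n = false & v n = true].
Proof.
split=> [[m [u' [v' [-> ->]]]]|[n [uv un vn]]].
  exists (size m); rewrite /wcat; split.
  - by move=> i im; rewrite !nth_rcons im; exact: set_nth_default.
  - by rewrite nth_rcons ltnn eqxx.
  - by rewrite nth_rcons ltnn eqxx.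
have catE b (w : cantor_space) : (forall i, (i < n)%N -> u i = w i) ->
    w n = b -> w = wcat (rcons (mkseq u n) b) (fun i => w (i + n.+1)%N).
  move=> uw wn; apply/funext => i.
  rewrite /wcat size_rcons size_mkseq nth_rcons size_mkseq.
  have [ltin|gtin|->//] := ltngtP i n; first by rewrite nth_mkseq// uw.
  by rewrite subnK.
by exists (mkseq u n), (fun i => u (i + n.+1)%N), (fun i => v (i + n.+1)%N);
  split; exact: catE.
Qed.

Lemma lex_lt_total (u v : cantor_space) : u <> v -> lex_lt u v \/ lex_lt v u.
Proof.
move=> uv; have [n uvn] : exists n, u n != v n.
  apply: contra_notP uv => /forallNP uv; apply/funext => n.
  by apply/eqP; apply: contra_notT (uv n).
case: (@ex_minnP (fun n => u n != v n)) => [|k]; first by exists n.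
move=> uvk kmin.
have agree i : (i < k)%N -> u i = v i.
  by move=> ik; apply/eqP; apply: contraTT ik => /kmin; rewrite -leqNgt.
case uk: (u k) uvk; case vk: (v k) => // _; [right|left]; apply/lex_ltP.
  by exists k; split=> // i /agree.
by exists k.
Qed.

Lemma closed_lex_min (D : set cantor_space) : closed D -> D !=set0 ->
  exists2 u, D u & forall v, lex_lt v u -> ~ D v.
Proof.
move=> Dclosed [d0 Dd0].
(* [d n] is an element of D whose first n letters are final: step n switches
   to an element of D with the same n first letters and letter n equal to
   false, if there is one. *)
pose better n (d : cantor_space) : set cantor_space :=
  [set v | [/\ D v, forall i, (i < n)%N -> v i = d i & v n = false]].
pose d := fix d n := if n is k.+1 then xget (d k) (better k (d k)) else d0.
have dS n i : (i < n)%N -> d n.+1 i = d n i.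
  by move=> ni /=; case: xgetP => // v _ [_ /(_ _ ni)].
have Dd n : D (d n) by elim: n => // n IH /=; case: xgetP => // v _ [].
pose u : cantor_space := fun n => d n.+1 n.
have du n i : (i < n)%N -> d n i = u i.
  elim: n => // n IH; rewrite ltnS leq_eqVlt => /predU1P[->//|ni].
  by rewrite dS// IH.
exists u => [|v /lex_ltP[n [vu vn un]] Dv].
  (* The letters of [d n] are eventually those of [u], so [u] is a limit of points of the closed set
     [D]. *)
  apply: (@closed_cvg _ _ \oo _ d _ Dclosed); first exact: nearW.
  apply: cvg_cantor => n; exists n.+1 => // k /=; exact: du.
(* A smaller [v] in [D], first differing from [u] at [n], would be a candidate at step [n], forcing
   [u n] to be false. *)
move: un; rewrite /u /=; case: xgetP => [w _ [_ _ ->]//|/(_ v)].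
by case; split=> // i ni; rewrite vu// du.
Qed.

(** * Prepending and removing a first letter *)

Definition wcons (b : bool) (u : cantor_space) : cantor_space :=
  fun n => if n is k.+1 then u k else b.

Definition wtail (u : cantor_space) : cantor_space := fun n => u n.+1.

Lemma wcons_tail (u : cantor_space) : wcons (u 0) (wtail u) = u.
Proof. by apply/funext => -[]. Qed.

Lemma wcons_continuous b : continuous (wcons b).
Proof.
move=> u; apply: cvg_cantor => -[|n] /=; first exact: nearW.
exact: near_letter.
Qed.

Lemma wtail_continuous : continuous wtail.
Proof. by move=> u; apply: cvg_cantor => n; exact: near_letter. Qed.

Lemma lex_lt_wcons b (u v : cantor_space) :
  lex_lt (wcons b u) (wcons b v) <-> lex_lt u v.
Proof.
split=> /lex_ltP[n [uv un vn]]; apply/lex_ltP.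
  case: n uv un vn => [_ /= -> //|n uv un vn].
  by exists n; split=> // i ni; exact: (uv i.+1).
by exists n.+1; split=> // -[|i] //; exact: uv.
Qed.

Lemma lex_lt_wcons01 (u v : cantor_space) : lex_lt (wcons false u) (wcons true v).
Proof. by apply/lex_ltP; exists 0. Qed.

Lemma lex_lt_wcons10 (u v : cantor_space) : ~ lex_lt (wcons true u) (wcons false v).
Proof. by move=> /lex_ltP[[[]//|n [/(_ 0 isT)]]]. Qed.

(** * Continuous functions: halves, gluing and points of disagreement *)

Section flag_web.
Context (T : Type).
Implicit Types (f : flag_web T) (F : set (flag_web T)).

Lemma flag_webP f g : (forall u, flag_eval u f = flag_eval u g) -> f = g.
Proof. by move=> fg; apply/continuousEP. Qed.

Lemma near_flag f (u : cantor_space) :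
  \forall v \near u, flag_eval v f = flag_eval u f.
Proof. by apply: (continuous_discreteP f).1 u; exact: cts_fun. Qed.

Definition flag_cst (x : T) : flag_web T :=
  @cst cantor_space (discrete_topology {classic T}) x.

Lemma flag_half_continuous b f :
  continuous (fun u => f (wcons b u) : discrete_topology {classic T}).
Proof.
by move=> u; apply: continuous_comp; [exact: wcons_continuous | exact: cts_fun].
Qed.

Definition flag_half b f : flag_web T := mkcts (@flag_half_continuous b f).

(** The first letter is locally constant, so near each word only one of [f] and [g] is used. *)
Lemma flag_glue_continuous f g : continuous
  (fun u : cantor_space =>
     (if u 0 then g else f) (wtail u) : discrete_topology {classic T}).
Proof.
apply/continuous_discreteP => u.
have := wtail_continuous (near_flag (if u 0 then g else f) (wtail u)).
apply: filterS2 (near_letter u 0) => v v0.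
by rewrite /= v0.
Qed.

Definition flag_glue f g : flag_web T := mkcts (@flag_glue_continuous f g).

Lemma flag_eval_half u b F :
  flag_eval u @` (flag_half b @` F) = flag_eval (wcons b u) @` F.
Proof. by rewrite image_comp. Qed.

Lemma singletons_flag_eval F : F !=set0 ->
  singletons F <-> forall u, singletons (flag_eval u @` F).
Proof.
move=> [f Ff]; split=> [[g _ <-] u|FS].
  by exists (flag_eval u g); rewrite ?image_set1.
apply/(singletonsP Ff) => g Fg; apply: flag_webP => u.
have Fuf : (flag_eval u @` F) (flag_eval u f) by exists f.
by apply: ((singletonsP Fuf).1 (FS u)); exists g.
Qed.

(** For a fixed [f] in [F], this set is the finite union over [g] in [F] of the sets where [g] and
    [f] differ, each closed because [f] and [g] are locally constant. *)
Lemma closed_flag_not_singletons F : finite_nonempty F ->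
  closed [set u | ~ singletons (flag_eval u @` F)].
Proof.
move=> [Ffin [f Ff]].
rewrite (_ : mkset _ =
    \bigcup_(g in F) [set u | flag_eval u g <> flag_eval u f]).
  apply: (@closed_bigcup _ (continuousType cantor_space _)) => // g Fg.
  rewrite -openC openE => u /contrapT /= gfu.
  apply: filterS2 (near_flag g u) (near_flag f u) => v /= gv fv.
  by apply; rewrite gv fv.
have Fu u : (flag_eval u @` F) (flag_eval u f) by exists f.
apply/seteqP; split=> u /=.
  apply: contra_notP => nFu; apply/(singletonsP (Fu u)) => _ [g Fg <-].
  by apply: contrapT => gf; apply: nFu; exists g.
by move=> [g Fg gf] /(singletonsP (Fu u)) FS; apply: gf; apply: FS; exists g.
Qed.

End flag_web.

(** * Strict coherence in [flag] and self-duality *)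

Lemma flag_strictP (X : hypercoherence) (F : set (flag_web (web X))) :
  flag_strict X F <-> finite_nonempty F /\
    exists2 u, strict_coh X (flag_eval u @` F) &
      forall v, lex_lt v u -> singletons (flag_eval v @` F).
Proof.
split=> [[Ffin [u [Fu Fv]]]|[Ffin [u Fu Fv]]]; split=> //; exists u => //.
  by move=> v vu; apply/card_eq1P; exact: Fv.
by split=> // v vu; apply/card_eq1P; exact: Fv.
Qed.

(** Self-duality is an equality of records on the same web; proof irrelevance reduces it to an
    equality of atomic coherences. *)
Lemma hypercoherence_eq (T : Type) (C C' : set (set T))
    (Cf : C `<=` finite_nonempty) (Cs : singletons `<=` C)
    (C'f : C' `<=` finite_nonempty) (C's : singletons `<=` C') :
  C = C' -> Hypercoherence Cf Cs = Hypercoherence C'f C's.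
Proof.
move=> CC'; subst C'.
by rewrite (Prop_irrelevance Cf C'f) (Prop_irrelevance Cs C's).
Qed.

Lemma dual_flag (A : hypercoherence) : dual (flag A) = flag (dual A).
Proof.
apply: hypercoherence_eq; apply/seteqP; split=> F.
  move=> [Ffin]; rewrite strict_coh_flag => nF.
  have [FS|nFS] := pselect (singletons F); [by right | left; split=> //].
  have D0 : [set u | ~ singletons (flag_eval u @` F)] !=set0.
    apply/not_existsP => D0; apply: nFS.
    apply/(singletons_flag_eval Ffin.2) => u.
    exact: contrapT (D0 u).
  (* At this first word of disagreement, strict coherence in [A] would contradict [nF]. *)
  have [u /= Fu Fv] := closed_lex_min (closed_flag_not_singletons Ffin) D0.
  have {}Fv v (vu : lex_lt v u) := contrapT (Fv v vu).
  apply/flag_strictP; split=> //; exists u => //; split=> //; split.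
    exact: finite_nonempty_image.
  by move=> Fu_strict; apply: nF; apply/flag_strictP; split=> //; exists u.
case=> [[_ /flag_strictP[Ffin [u [[_ nFu] nFuS] Fv]]]|FS].
  split=> //; rewrite strict_coh_flag => /flag_strictP[_ [v [cFv nFvS] Fw]].
  (* Both [u] and [v] are first words of disagreement, hence equal; the values there would be both
     strictly coherent and not. *)
  have [uv|/lex_lt_total[uv|vu]] := pselect (u = v).
  - by apply: nFu; rewrite uv.
  - exact/nFuS/Fw.
  - exact/nFvS/Fv.
split; first exact: singletons_finite_nonempty.
by move=> [].
Qed.

(** * The embedding by constant functions *)

Lemma retract_flag (A : hypercoherence) : retract A (flag A).
Proof.
have eval_cst u (w : set (web A)) :
    flag_eval u @` (@flag_cst (web A) @` w) = w.
  by rewrite image_comp (_ : _ \o _ = id) ?image_id.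
apply: (@retract_embedding A (flag A) (@flag_cst (web A))) => [x y xy|w wfin].
  exact: (congr1 (flag_eval point) xy).
rewrite strict_coh_flag; split=> [sw|/flag_strictP[_ [u]]]; last by rewrite eval_cst.
apply/flag_strictP; split; first exact: finite_nonempty_image.
(* No word lies below the all-false one, so the condition on smaller words is vacuous. *)
exists (fun=> false); first by rewrite eval_cst.
by move=> v /lex_ltP[n []].
Qed.

(** * Splitting a flag into its two halves *)

Lemma flag_strict_half (A : hypercoherence) (F : set (flag_web (web A))) :
  finite_nonempty F ->
  flag_strict A F <->
    flag_strict A (flag_half false @` F) \/
    singletons (flag_half false @` F) /\ flag_strict A (flag_half true @` F).
Proof.
move=> Ffin; have halffin b := finite_nonempty_image (flag_half b) Ffin.
split.
  move=> /flag_strictP[_ [u]]; rewrite -{1 2}(wcons_tail u).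
  (* A witness starting with true exceeds every word starting with false, so [F] is constant on the
     first half. *)
  case: (u 0) => Fu Fv; [right|left].
    split; last first.
      apply/flag_strictP; split=> //; exists (wtail u); rewrite ?flag_eval_half//.
      by move=> v vu; rewrite flag_eval_half; apply: Fv; apply/lex_lt_wcons.
    apply/(singletons_flag_eval (halffin false).2) => v.
    by rewrite flag_eval_half; apply: Fv; exact: lex_lt_wcons01.
  apply/flag_strictP; split=> //; exists (wtail u); rewrite ?flag_eval_half//.
  by move=> v vu; rewrite flag_eval_half; apply: Fv; apply/lex_lt_wcons.
case=> [/flag_strictP[_ [u]]|[FS /flag_strictP[_ [u]]]];
  rewrite flag_eval_half => Fu Fv; apply/flag_strictP; split=> //.
  exists (wcons false u) => // v; rewrite -(wcons_tail v).
  case: (v 0) => [/lex_lt_wcons10//|/lex_lt_wcons/Fv].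
  by rewrite flag_eval_half.
exists (wcons true u) => // v; rewrite -(wcons_tail v).
case: (v 0) => [/lex_lt_wcons/Fv|_]; first by rewrite flag_eval_half.
rewrite -flag_eval_half.
exact: ((singletons_flag_eval (halffin false).2).1 FS).
Qed.

Lemma isomorphic_flag_before (A : hypercoherence) :
  isomorphic (flag A) (before (flag A) (flag A)).
Proof.
pose h (f : flag_web (web A)) := (flag_half false f, flag_half true f).
apply: (@isomorphic_embedding (flag A) (before (flag A) (flag A)) h).
- move=> f g fg; apply: flag_webP => u; rewrite -(wcons_tail u).
  case: (u 0).
    exact: (congr1 (fun p => flag_eval (wtail u) p.2) fg).
  exact: (congr1 (fun p => flag_eval (wtail u) p.1) fg).
- move=> F Ffin; rewrite strict_coh_before strict_coh_flag flag_strict_half//.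
  rewrite /before_strict /= strict_coh_flag !image_comp.
  (* The projections of [h] are the two halves, so the goal becomes the criterion of
     [flag_strict_half]. *)
  rewrite -[_ \o h]/(flag_half false) -[_ \o h]/(flag_half true).
  rewrite card_eq1P; split=> [?|[]//]; split=> //.
  exact: finite_nonempty_image.
- move=> [f g]; exists (flag_glue f g).
  by congr pair; apply: flag_webP.
Qed.

Theorem proposition24 (A : hypercoherence) :
  dual (flag A) = flag (dual A) /\
  retract A (flag A) /\
  isomorphic (flag A) (before (flag A) (flag A)).
Proof.
split; first exact: dual_flag.
by split; [exact: retract_flag | exact: isomorphic_flag_before].
Qed.
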